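(* Let $(X,\kappa_1)$ and $(Y,\kappa_2)$ be connected digital images with $\#Y>1$. Then for every $i\geq 2$ there exist continuous maps $f_1,\ldots,f_i : X\to Y$ such that $C(f_1,\ldots,f_i)=\emptyset$.
   Context: A digital image is a pair $(X,\kappa)$ with $X\subset\mathbb{Z}^n$ for some $n\in\mathbb{N}$ and $\kappa$ a symmetric, antireflexive (irreflexive) relation on $X$, called the adjacency. A subset of $X$ is $\kappa$-connected if it is not a union of two disjoint non-empty sets $A,B$ such that no point of $A$ is $\kappa$-adjacent to a point of $B$; the digital image is connected if $X$ itself is $\kappa$-connected. A function $f:(X,\kappa_1)\to(Y,\kappa_2)$ is (digitally) continuous if it maps every $\kappa_1$-connected subset of $X$ to a $\kappa_2$-connected subset of $Y$; equivalently, whenever $x,y\in X$ are $\kappa_1$-adjacent, $f(x)$ and $f(y)$ are equal or $\kappa_2$-adjacent. The coincidence point set is $C(f_1,\ldots,f_i)=\{x\in X : f_1(x)=\cdots=f_i(x)\}$. $\#A$ denotes the cardinality of $A$. *)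

(* Defs.v *)
From mathcomp Require Import all_boot all_order all_algebra.
From mathcomp Require Import boolp classical_sets functions cardinality.

Set Implicit Arguments.
Unset Strict Implicit.
Unset Printing Implicit Defensive.

Local Open Scope classical_set_scope.

(* The point set may be infinite or empty.  Through the coercions
   [digital_image >-> set >-> Sortclass], [X : digital_image] used as a type is
   the subtype of the points of Z^(image_dim X) lying in the point set. *)
Record digital_image := DigitalImage {
  image_dim : nat;
  image_points :> set 'rV[int]_image_dim;
  adjacent : image_points -> image_points -> Prop;
  adjacent_sym : forall x y, adjacent x y -> adjacent y x;
  adjacent_irrefl : forall x, ~ adjacent x x
}.

Definition digitally_connected (X : digital_image) (S : set X) : Prop :=
  ~ exists A B : set X,
      [/\ S = A `|` B, A `&` B = set0, A !=set0, B !=set0 &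
          forall a b, A a -> B b -> ~ adjacent a b].

Definition connected_image (X : digital_image) : Prop :=
  digitally_connected [set: X].

Definition digitally_continuous (X Y : digital_image) (f : X -> Y) : Prop :=
  forall S : set X, digitally_connected S -> digitally_connected (f @` S).

Definition coincidence_set (X Y : digital_image) (i : nat)
    (f : 'I_i -> X -> Y) : set X :=
  [set x | forall j k : 'I_i, f j x = f k x].

(* Main.v *)
Require Import Defs.
From mathcomp Require Import all_boot all_order all_algebra.
From mathcomp Require Import boolp classical_sets functions cardinality.

Local Open Scope classical_set_scope.
Local Open Scope card_scope.

(** Constant maps are continuous, and two constant maps with distinct values agree nowhere. Since
    [Y] has two distinct points, one map can be constant at the first and all the others constant at
    the second. *)

(** The image has at most one point, so two non-empty parts covering it would both contain [y] and
    could not be disjoint. *)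
Lemma digitally_continuous_cst (X Y : digital_image) (y : Y) :
  @digitally_continuous X Y (fun=> y).
Proof.
move=> S _ [A [B [SAB AB0 [a Aa] [b Bb] _]]].
have AUB_y c : (A `|` B) c -> c = y by rewrite -SAB => -[? _ <-].
have ay : a = y by apply: AUB_y; left.
have by' : b = y by apply: AUB_y; right.
have : (A `&` B) y by split; [rewrite -ay | rewrite -by'].
by rewrite AB0.
Qed.

(** By contraposition: if all points of [A] are equal, [A] is empty or lies in a singleton. *)
Lemma card_gt1_exists_neq (T : Type) (A : set T) :
  ~~ (A #<= `I_1) -> exists a b : A, a <> b.
Proof.
move=> /negP cardA; apply: contrapT => all_eq; apply: cardA.
have [[a Aa]|/nonemptyPn->] := pselect (A !=set0); last first.
  exact: card_ge0.
have /subset_card_le/card_le_trans : A `<=` [set a].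
  move=> b Ab; apply: contrapT => ba; apply: all_eq.
  exists (SigSub (mem_set Ab)), (SigSub (mem_set Aa)).
  by move=> /(congr1 set_val).
by apply; rewrite (card_le_eql card_set1).
Qed.

Theorem proposition3p3 (X Y : digital_image)
    (hX : connected_image X) (hY : connected_image Y)
    (hcardY : ~~ (Y #<= `I_1)) (i : nat) (hi : (2 <= i)%N) :
  exists f : 'I_i -> X -> Y,
    (forall j : 'I_i, digitally_continuous (f j)) /\
    coincidence_set f = set0.
Proof.
have [y0 [y1 y01]] := card_gt1_exists_neq _ _ hcardY.
exists (fun j => fun=> if (j : nat) == 0%N then y0 else y1); split.
  by move=> j; exact: digitally_continuous_cst.
(* Indices 0 and 1 both exist because [2 <= i]; comparing them at a coincidence point [x] gives
   [y0 = y1]. *)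
apply/nonemptyPn => -[x] /(_ (Ordinal (ltnW hi)) (Ordinal hi)).
exact: y01.
Qed.
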